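(* The functors $\mathfrak{L}$, from simplicial sets to complete differential graded Lie algebras, and $\langle\,\cdot\,\rangle$, from complete differential graded Lie algebras to simplicial sets, are adjoint. More precisely, for any simplicial set $K$ and any complete differential graded Lie algebra $L$ there is a bijection $$\mathbf{SimpSet}(K,\langle L\rangle)\cong\mathbf{DGL}(\mathfrak{L}(K),L).$$
   Context: The base field is $\mathbb{Q}$. A differential graded Lie algebra (DGL) is a $\mathbb{Z}$-graded Lie algebra $L$ with a linear derivation $\partial$ of degree $-1$, $\partial^2=0$. Put $L^1=L$, $L^n=[L,L^{n-1}]$; $L$ is complete if $L\cong\varprojlim_n L/L^n$. $\mathbf{DGL}$ is the category of complete DGL's and $\mathbf{SimpSet}$ that of simplicial sets. $\widehat{\mathbb{L}}(V)=\varprojlim_n\mathbb{L}(V)/\mathbb{L}^{>n}(V)$ is the completion of the free graded Lie algebra $\mathbb{L}(V)$. For a differential $\partial$ on $\widehat{\mathbb L}(V)$, $\partial_1$ denotes its linear part ($\partial_1v\in V$ is the component of $\partial v$ of bracket length $1$). A Maurer-Cartan element of $(L,\partial)$ is $a\in L_{-1}$ with $\partial a+\frac12[a,a]=0$. $\widehat{\mathbb{L}}(\Delta^n)$ denotes the free complete graded Lie algebra on generators $a_{i_0\dots i_p}$ of degree $p-1$, one for each sequence $0\le i_0<\dots<i_p\le n$, $0\le p\le n$. Let $d a_{i_0\dots i_p}=\sum_{j=0}^p(-1)^ja_{i_0\dots\widehat{i_j}\dots i_p}$ ($d a_i=0$), and let $\delta_i\colon\widehat{\mathbb{L}}(\Delta^{n-1})\to\widehat{\mathbb{L}}(\Delta^n)$,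 $0\le i\le n$, be the Lie morphism $\delta_i(a_{j_0\dots j_p})=a_{\ell_0\dots\ell_p}$, where $\ell_k=j_k$ if $j_k<i$ and $\ell_k=j_k+1$ if $j_k\ge i$. A sequence of compatible models of $\mathbf\Delta$ is a family of DGL's $\{\mathfrak{L}_n=(\widehat{\mathbb{L}}(\Delta^n),\partial)\}_{n\ge0}$ such that: (1) each $a_i$ is a Maurer-Cartan element; (2) $\partial_1=d$; (3) each $\delta_i$ is a DGL morphism. Fix such a sequence together with a cosimplicial DGL structure on $\mathfrak{L}_\bullet$ whose cofaces are the $\delta_i$ (such data exist). Realization: $\langle L\rangle$ is the simplicial set $\langle L\rangle_\bullet=\mathbf{DGL}(\mathfrak{L}_\bullet,L)$. Model functor: let $\underline{\mathbf\Delta}$ be the simplex category and $I\colon\underline{\mathbf\Delta}\to\mathbf{SimpSet}$ the functor sending $[n]$ to the standard simplicial set $\underline\Delta^n$. Then $\mathfrak{L}$ is the left Kan extension of $\mathfrak{L}_\bullet\colon\underline{\mathbf\Delta}\to\mathbf{DGL}$ along $I$, i.e. $\mathfrak{L}(K)=\varinjlim_{f\colon\underline\Delta^n\to K}\mathfrak{L}_n$, the colimit in $\mathbf{DGL}$ over the comma category $I\downarrow K$.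
   Formalization: The bijection, natural in K and L, is stated for every simplicial set K whose colimit 𝔏(K) exists among complete DGL's (and as an adjunction if it exists for all K); with completeness as defined it fails to exist for some K, such as an infinite wedge of circles. *)

(* Defs.v *)
From HB Require Import structures.
From mathcomp Require Import all_boot all_order all_algebra.
From mathcomp Require Import all_classical.
From mathcomp Require Import ring lra zify.
Set Implicit Arguments.
Unset Strict Implicit.
Unset Printing Implicit Defensive.
Import Order.TTheory GRing.Theory Num.Theory.
Local Open Scope classical_set_scope.
Local Open Scope ring_scope.

(* A graded space is a family of Q-vector spaces indexed by the degree.  The
   degree of a bracket (and, below, of a differential) is passed together with
   the equation it satisfies, so that no transport between degrees is needed. *)
Record gla := Gla {
  gr :> int -> lmodType rat;
  br : forall i j k : int, i + j = k -> gr i -> gr j -> gr k;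
  br_linl : forall (i j k : int) (e : i + j = k) (y : gr j),
    linear (fun x : gr i => br e x y);
  br_linr : forall (i j k : int) (e : i + j = k) (x : gr i),
    linear (br e x);
  br_anti : forall (i j k : int) (e : i + j = k) (e' : j + i = k)
      (x : gr i) (y : gr j),
    br e x y = - ((-1) ^ (i * j) *: br e' y x);
  br_jacobi : forall (i j k ij jk ik n : int)
      (eij : i + j = ij) (ejk : j + k = jk) (eik : i + k = ik)
      (e1 : i + jk = n) (e2 : ij + k = n) (e3 : j + ik = n)
      (x : gr i) (y : gr j) (z : gr k),
    br e1 x (br ejk y z) =
    br e2 (br eij x y) z + (-1) ^ (i * j) *: br e3 y (br eik x z) }.

Inductive lin_span (V : lmodType rat) (A : set V) : set V :=
| lin_span_gen v : A v -> lin_span A v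
| lin_span_zero : lin_span A 0
| lin_span_lin a u v : lin_span A u -> lin_span A v -> lin_span A (a *: u + v).

(* [lcs L n] is L^{n+1}: L^1 = L and L^{n+1} = [L, L^n]. *)
Fixpoint lcs (L : gla) (n : nat) (k : int) : set (L k) :=
  if n is m.+1 then
    lin_span [set z | exists (i j : int) (e : i + j = k) (x : L i) (y : L j),
                    lcs m y /\ z = br e x y]
  else setT.
Arguments lcs L n k _ : clear implicits.

Definition lcs_coset (L : gla) (n : nat) (k : int) (x : L k) : set (L k) :=
  [set y | lcs L n k (y - x)].

(* The canonical map from L to lim_n L/L^n is bijective in every degree; the
   elements of L/L^n are cosets, and a point of the limit is a decreasing
   sequence of cosets. *)
Definition complete (L : gla) : Prop :=
  forall (k : int) (c : nat -> set (L k)),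
    (forall n, exists x, c n = lcs_coset n x) ->
    (forall n, c n.+1 `<=` c n) ->
    exists! x : L k, forall n, c n = lcs_coset n x.

Record differential (L : gla) := Differential {
  diff : forall i j : int, i - 1 = j -> L i -> L j;
  diff_lin : forall (i j : int) (e : i - 1 = j), linear (@diff i j e);
  diff_der : forall (i j k i' j' k' : int)
      (ei : i - 1 = i') (ej : j - 1 = j') (ek : k - 1 = k')
      (e : i + j = k) (e1 : i' + j = k') (e2 : i + j' = k')
      (x : L i) (y : L j),
    diff ek (br e x y) =
    br e1 (diff ei x) y + (-1) ^ i *: br e2 x (diff ej y);
  diff_sq : forall (i j k : int) (e : i - 1 = j) (e' : j - 1 = k) (x : L i),
    diff e' (diff e x) = 0 }.

(* Complete differential graded Lie algebras. *)
Record dgl := Dgl {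
  dgl_gla :> gla;
  dd : differential dgl_gla;
  dgl_complete : complete dgl_gla }.

Record dgl_hom (L M : dgl) := DglHom {
  dgl_fun :> forall k : int, L k -> M k;
  dgl_hom_lin : forall k, linear (@dgl_fun k);
  dgl_hom_br : forall (i j k : int) (e : i + j = k) (x : L i) (y : L j),
    dgl_fun (br e x y) = br e (dgl_fun x) (dgl_fun y);
  dgl_hom_diff : forall (i j : int) (e : i - 1 = j) (x : L i),
    dgl_fun (diff (dd L) e x) = diff (dd M) e (dgl_fun x) }.

Definition maurer_cartan (L : dgl) (a : L (-1)) : Prop :=
  diff (dd L) (erefl : -1 - 1 = -2 :> int) a
  + 2%:R^-1 *: br (erefl : -1 + -1 = -2 :> int) a a = 0.

Section FreeLie.
Variables (X : finType) (deg : X -> int).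
(* Noncommutative formal power series over X: the completed tensor algebra on
   the graded vector space V with basis X. *)
Notation fps := (seq X -> rat^o).
Implicit Types (f g h : fps) (w : seq X).

Definition word w : fps := fun u => (u == w)%:R.

Definition conv f g : fps :=
  fun w => \sum_(i < (size w).+1) f (take i w) * g (drop i w).

Definition cbr (i j : int) f g : fps :=
  conv f g - (-1) ^ (i * j) *: conv g f.

(* 𝕃(V) is realised, as usual in characteristic zero, as the graded Lie
   subalgebra of the tensor algebra generated by V; [lie_elt k l] is its part
   of degree k and bracket length l. *)
Inductive lie_elt : int -> nat -> fps -> Prop :=
| lie_gen x : lie_elt (deg x) 1 (word [:: x])
| lie_zero k l : lie_elt k l 0
| lie_lin k l a f g : lie_elt k l f -> lie_elt k l g -> lie_elt k l (a *: f + g)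
| lie_br i j l m f g : lie_elt i l f -> lie_elt j m g ->
    lie_elt (i + j) (l + m) (cbr i j f g).

(* The component of word length l. *)
Definition lpart (l : nat) f : fps := fun w => f w *+ (size w == l).

(* A degree-k element of lim_n 𝕃(V)/𝕃^{>n}(V) is a choice, for every l, of a
   component of degree k and bracket length l; the components are collected in
   one series. *)
Definition lie_series (k : int) : pred fps :=
  fun f => `[< forall l, lie_elt k l (lpart l f) >].

Lemma lpart_lin l a f g : lpart l (a *: f + g) = a *: lpart l f + lpart l g.
Proof.
apply/funext => w; rewrite /lpart !fctE.
by rewrite mulrnDl -scalerMnr.
Qed.

Lemma lpart0 l : lpart l 0 = 0.
Proof. by apply/funext => w; exact: mul0rn. Qed.

Record hatL (k : int) := HatL {
  ser :> fps;
  serP : lie_series k ser }.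

HB.instance Definition _ k := [isSub for @ser k].
HB.instance Definition _ k := [Choice of hatL k by <:].

Fact hatL_submod k : submod_closed (lie_series k).
Proof.
split=> [|a f g].
  by apply/asboolP => l; rewrite lpart0; exact: lie_zero.
move=> /asboolP hf /asboolP hg; apply/asboolP => l.
by rewrite lpart_lin; exact: lie_lin.
Qed.
HB.instance Definition _ k := GRing.isSubmodClosed.Build _ _ _ (hatL_submod k).
HB.instance Definition _ k := [SubChoice_isSubLmodule of hatL k by <:].

Lemma conv_nil f g : conv f g [::] = f [::] * g [::].
Proof. by rewrite /conv /= big_ord_recl big_ord0 addr0. Qed.

Lemma conv_cons f g x w :
  conv f g (x :: w) = f [::] * g (x :: w) + conv (fun u => f (x :: u)) g w.
Proof. by rewrite /conv /= big_ord_recl /=. Qed.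

Lemma conv_linl a f g h : conv (a *: f + g) h = a *: conv f h + conv g h.
Proof.
apply/funext => w; rewrite !fctE /conv scaler_sumr -big_split /=.
by apply: eq_bigr => i _; rewrite /GRing.scale /=; ring.
Qed.

Lemma conv_linr a f g h : conv h (a *: f + g) = a *: conv h f + conv h g.
Proof.
apply/funext => w; rewrite !fctE /conv scaler_sumr -big_split /=.
by apply: eq_bigr => i _; rewrite /GRing.scale /=; ring.
Qed.

Lemma conv0l h : conv 0 h = 0.
Proof. by apply/funext => w; rewrite /conv big1 // => i _; exact: mul0r. Qed.

Lemma conv0r h : conv h 0 = 0.
Proof. by apply/funext => w; rewrite /conv big1 // => i _; exact: mulr0. Qed.

Lemma convA f g h : conv f (conv g h) = conv (conv f g) h.
Proof.
apply/funext => w; elim: w f g => [|x w IH] f g.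
  by rewrite !conv_nil mulrA.
rewrite !conv_cons IH.
have -> : (fun u => conv f g (x :: u)) =
   (f [::] *: (fun u => g (x :: u)) + conv (fun u => f (x :: u)) g : fps).
  by apply/funext => u; rewrite conv_cons !fctE.
rewrite conv_linl !fctE /GRing.scale /=.
rewrite conv_nil; ring.
Qed.

Lemma sgnE (n : int) : ((-1) ^ n : rat) = 1 \/ ((-1) ^ n : rat) = -1.
Proof.
case: n => n; last rewrite NegzE -exprnN; rewrite -?exprnP -signr_odd;
  by case: odd => /=; rewrite ?expr0 ?expr1 ?invrN ?invr1; auto.
Qed.

Lemma sgnD (n m : int) : ((-1) ^ (n + m) : rat) = (-1) ^ n * (-1) ^ m.
Proof. by rewrite expfzDr. Qed.

Lemma cbr_anti i j f g : cbr i j f g = - ((-1) ^ (i * j) *: cbr j i g f).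
Proof.
apply/funext => w; rewrite /cbr !fctE /GRing.scale /= [j * i]mulrC.
by case: (sgnE (i * j)) => ->; ring.
Qed.

Lemma conv_subZr (a : rat) f g h : conv h (f - a *: g) = conv h f - a *: conv h g.
Proof. by rewrite addrC -scaleNr conv_linr addrC scaleNr. Qed.

Lemma conv_subZl (a : rat) f g h : conv (f - a *: g) h = conv f h - a *: conv g h.
Proof. by rewrite addrC -scaleNr conv_linl addrC scaleNr. Qed.

Lemma cbr_jacobi i j k f g h :
  cbr i (j + k) f (cbr j k g h) =
  cbr (i + j) k (cbr i j f g) h + (-1) ^ (i * j) *: cbr j (i + k) g (cbr i k f h).
Proof.
apply/funext => w; rewrite /cbr !conv_subZl !conv_subZr !convA !fctE /GRing.scale /=.
rewrite !(mulrDl, mulrDr) !sgnD (mulrC j i).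
by case: (sgnE (i * j)) => ->; case: (sgnE (i * k)) => ->;
  case: (sgnE (j * k)) => ->; ring.
Qed.

Lemma cbr_linl i j a f g h : cbr i j (a *: f + g) h = a *: cbr i j f h + cbr i j g h.
Proof.
rewrite /cbr conv_linl conv_linr; apply/funext => w.
by rewrite !fctE /GRing.scale /=; ring.
Qed.

Lemma cbr_linr i j a f g h : cbr i j h (a *: f + g) = a *: cbr i j h f + cbr i j h g.
Proof.
rewrite /cbr conv_linl conv_linr; apply/funext => w.
by rewrite !fctE /GRing.scale /=; ring.
Qed.

Lemma cbr0l i j f : cbr i j 0 f = 0.
Proof. by rewrite /cbr conv0l conv0r scaler0 subr0. Qed.

Lemma cbr0r i j f : cbr i j f 0 = 0.
Proof. by rewrite /cbr conv0l conv0r scaler0 subr0. Qed.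

Lemma lie_elt_sum (I : Type) (r : seq I) (F : I -> fps) k l :
  (forall i, lie_elt k l (F i)) -> lie_elt k l (\sum_(i <- r) F i).
Proof.
move=> hF; elim: r => [|i r IH]; first by rewrite big_nil; exact: lie_zero.
by rewrite big_cons -[F i]scale1r; exact: lie_lin.
Qed.

Lemma lpart_conv l f g :
  lpart l (conv f g) = \sum_(p < l.+1) conv (lpart p f) (lpart (l - p) g).
Proof.
apply/funext => w; rewrite fct_sumE /lpart /conv.
have [<-|neq] := eqVneq (size w) l; last first.
  rewrite mulr0n; symmetry; apply: big1 => p _; apply: big1 => i _.
  have hi : (i <= size w)%N by rewrite -ltnS.
  rewrite size_takel // size_drop; have [ip|] := eqVneq (i : nat) (p : nat);
    last by rewrite mulr0n mul0r.
  have [e|] := eqVneq (size w - i)%N (l - p)%N; last by rewrite mulr0n mulr0.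
  exfalso; move/eqP: neq; apply.
  have := ltn_ord p; lia.
rewrite mulr1n exchange_big /=; apply: eq_bigr => i _.
have hi : (i <= size w)%N by rewrite -ltnS.
rewrite (bigD1 i) //= size_takel // size_drop !eqxx !mulr1n big1 ?addr0 // => p hp.
by rewrite eq_sym (negPf (hp : (p : nat) != i)) mulr0n mul0r.
Qed.

Lemma lpart_cbr l i j f g :
  lpart l (cbr i j f g) = \sum_(p < l.+1) cbr i j (lpart p f) (lpart (l - p) g).
Proof.
rewrite /cbr addrC -scaleNr lpart_lin !lpart_conv big_split /= addrC; congr (_ + _).
rewrite scaler_sumr (reindex_inj rev_ord_inj) /=; apply: eq_bigr => p _.
by rewrite scaleNr subSS subKn // -ltnS.
Qed.

Fact hatL_br_subproof (i j k : int) (e : i + j = k) (f : hatL i) (g : hatL j) :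
  lie_series k (cbr i j f g).
Proof.
apply/asboolP => l; rewrite lpart_cbr; apply: lie_elt_sum => p.
have hp : (p <= l)%N by rewrite -ltnS.
have := lie_br (asboolW (serP f) p) (asboolW (serP g) (l - p)%N).
by rewrite e subnKC.
Qed.

Definition hatL_br (i j k : int) (e : i + j = k) (f : hatL i) (g : hatL j) : hatL k :=
  HatL (hatL_br_subproof e f g).

Lemma lpart_word w l : lpart l (word w) = if size w == l then word w else 0.
Proof.
apply/funext => u; rewrite /lpart.
have [<-|wl] := eqVneq (size w) l.
  by rewrite /word; have [->|] := eqVneq u w; rewrite ?eqxx //= mul0rn.
rewrite /word; have [->|] := eqVneq u w; last by rewrite mul0rn.
by rewrite (negPf wl).
Qed.

Fact hatL_gen_subproof (k : int) x (e : deg x = k) : lie_series k (word [:: x]).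
Proof.
apply/asboolP => l; rewrite lpart_word /= -e; case: eqP => [<-|_].
  exact: lie_gen.
exact: lie_zero.
Qed.

Definition hatL_gen (k : int) x (e : deg x = k) : hatL k := HatL (hatL_gen_subproof e).

Definition adsum k l h := exists g : X -> fps,
  (forall x, lie_elt (k - deg x) l (g x)) /\
  h = \sum_(x : X) cbr (deg x) (k - deg x) (word [:: x]) (g x).

Lemma adsum0 k l : adsum k l 0.
Proof.
exists (fun=> 0); split=> [x|]; first exact: lie_zero.
by rewrite big1 // => x _; rewrite cbr0r.
Qed.

Lemma adsum_lin k l a f g : adsum k l f -> adsum k l g -> adsum k l (a *: f + g).
Proof.
move=> [F [hF ->]] [G [hG ->]]; exists (fun x => a *: F x + G x); split=> [x|].
  exact: lie_lin.
rewrite scaler_sumr -big_split /=; apply: eq_bigr => x _.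
by rewrite cbr_linr.
Qed.

Lemma lie_elt0 k l f : lie_elt k l f -> l = 0%N -> f = 0.
Proof.
elim=> // {k l f} [k l a f g _ IHf _ IHg l0|i j l m f g _ IHf _ IHg /eqP].
  by rewrite IHf // IHg // scaler0 addr0.
by rewrite addn_eq0 => /andP[/eqP l0 _]; rewrite IHf // cbr0l.
Qed.

Lemma lie_br_adsum i l u : lie_elt i l u -> forall j m v, lie_elt j m v ->
  adsum (i + j) (l + m).-1 (cbr i j u v).
Proof.
elim=> {i l u} [x|k l|k l a f g _ IHf _ IHg|i1 i2 l1 l2 a b ha IHa hb IHb] j m v hv.
- exists (fun y => if y == x then v else 0); split=> [y|].
    by case: eqP => [->|_]; [rewrite addrC addKr | exact: lie_zero].
  rewrite (bigD1 x) //= eqxx big1 ?addr0; last first.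
    by move=> y /negPf ->; rewrite cbr0r.
  by rewrite [deg x + j]addrC addrK.
- by rewrite cbr0l; exact: adsum0.
- by rewrite cbr_linl; apply: adsum_lin; auto.
rewrite (_ : cbr _ _ _ _ = (- (-1) ^ (i1 * i2)) *: cbr i2 (i1 + j) b (cbr i1 j a v)
     + cbr i1 (i2 + j) a (cbr i2 j b v)); last first.
  by rewrite (cbr_jacobi i1 i2) scaleNr addrCA addNr addr0.
rewrite -addrA -addnA; apply: adsum_lin; last by apply: IHa; exact: lie_br.
rewrite addrCA addnCA; apply: IHb; exact: lie_br.
Qed.

Lemma lie_elt_adsum k l h : lie_elt k l h -> (1 < l)%N -> adsum k l.-1 h.
Proof.
elim=> // {k l h} [k l _|k l a f g _ IHf _ IHg hl|i j l m f g hf _ hg _ _].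
- exact: adsum0.
- by apply: adsum_lin; [exact: IHf | exact: IHg].
- exact: lie_br_adsum.
Qed.

Lemma lie_elt_supp k l f : lie_elt k l f -> lpart l f = f.
Proof.
elim=> {k l f} [x|k l|k l a f g _ IHf _ IHg|i j l m f g _ IHf _ IHg].
- by rewrite lpart_word.
- exact: lpart0.
- by rewrite lpart_lin IHf IHg.
have lpartC p q h : lpart q (lpart p h) = if q == p then lpart p h else 0.
  apply/funext => w; rewrite /lpart; have [->|qp] := eqVneq q p.
    by case: (size w == p); rewrite ?mulr1n ?mul0rn.
  have [->|] := eqVneq (size w) q; last by rewrite mulr0n.
  by rewrite (negPf qp) mul0rn.
have hl : (l < (l + m).+1)%N by rewrite ltnS leq_addr.
rewrite lpart_cbr (bigD1 (Ordinal hl)) //= addKn IHf IHg big1 ?addr0 // => p hp.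
rewrite -IHf lpartC (_ : (p : nat) == l = false) ?cbr0l //.
by apply: negbTE; apply: contraNneq hp => hp; apply/eqP; exact: val_inj.
Qed.

Lemma lpart_ext f g : (forall l, lpart l f = lpart l g) -> f = g.
Proof.
move=> h; apply/funext => w.
by have := congr1 (fun u : fps => u w) (h (size w)); rewrite /lpart /= eqxx.
Qed.

Lemma hatL_inj k (x y : hatL k) : (forall w, x w = y w) -> x = y.
Proof. by move=> h; apply: val_inj; exact: funext. Qed.

Fact hatL_linl (i j k : int) (e : i + j = k) (y : hatL j) :
  linear (fun x : hatL i => hatL_br e x y).
Proof. by move=> a x x'; apply: val_inj; exact: cbr_linl. Qed.

Fact hatL_linr (i j k : int) (e : i + j = k) (x : hatL i) :
  linear (hatL_br e x).
Proof. by move=> a y y'; apply: val_inj; exact: cbr_linr. Qed.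

Fact hatL_anti (i j k : int) (e : i + j = k) (e' : j + i = k)
    (x : hatL i) (y : hatL j) :
  hatL_br e x y = - ((-1) ^ (i * j) *: hatL_br e' y x).
Proof. by apply: val_inj; exact: cbr_anti. Qed.

Fact hatL_jacobi (i j k ij jk ik n : int)
    (eij : i + j = ij) (ejk : j + k = jk) (eik : i + k = ik)
    (e1 : i + jk = n) (e2 : ij + k = n) (e3 : j + ik = n)
    (x : hatL i) (y : hatL j) (z : hatL k) :
  hatL_br e1 x (hatL_br ejk y z) =
  hatL_br e2 (hatL_br eij x y) z
  + (-1) ^ (i * j) *: hatL_br e3 y (hatL_br eik x z).
Proof. by subst; apply: val_inj; exact: cbr_jacobi. Qed.

(* The free complete graded Lie algebra on generators X of degrees deg. *)
Definition free_gla : gla :=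
  Gla hatL_linl hatL_linr hatL_anti hatL_jacobi.

Lemma hatL_nil k (x : hatL k) : x [::] = 0.
Proof.
have /lie_elt0 h := asboolW (serP x) 0%N.
by have := congr1 (fun u : fps => u [::]) (h erefl).
Qed.

Lemma lin_span_sum (V : lmodType rat) (A : set V) (I : Type) (r : seq I) (F : I -> V) :
  (forall i, lin_span A (F i)) -> lin_span A (\sum_(i <- r) F i).
Proof.
move=> h; elim: r => [|i r IH]; first by rewrite big_nil; exact: lin_span_zero.
by rewrite big_cons -[F i]scale1r; exact: lin_span_lin.
Qed.

Lemma lcs_freeP n k (x : free_gla k) :
  lcs free_gla n k x <-> forall w, (size w <= n)%N -> x w = 0.
Proof.
elim: n k x => [|n IH] k x.
  by split=> // _ w; rewrite leqn0 size_eq0 => /eqP ->; exact: hatL_nil.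
split=> [|hx].
  elim=> {x} [_ [i [j [e [x [y [/IH hy ->]]]]]]|//|a u v _ hu _ hv] w hw; last first.
    by rewrite [LHS](_ : _ = a * u w + v w) // hu // hv // mulr0 addr0.
  rewrite /= /cbr !fctE /conv !big1 ?scaler0 ?subr0 // => p _.
    have [hp|hp] := leqP (size (take p w)) n; first by rewrite hy ?mul0r.
    have -> : drop p w = [::]; last by rewrite hatL_nil mulr0.
    apply/size0nil; rewrite size_drop; move: hp (ltn_ord p).
    by rewrite size_take_min /minn; case: ifP; lia.
  case: w hw p => [|a w] hw [[|p] hp]; rewrite ?hatL_nil ?mul0r //.
  by rewrite hy ?mulr0 //= size_drop; move: hw; rewrite /=; lia.
have {}hx l : exists g : X -> fps,
   [/\ forall y, lie_elt (k - deg y) l.-1 (g y),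
      lpart l x = \sum_y cbr (deg y) (k - deg y) (word [:: y]) (g y)
    & (l <= n.+1)%N -> g = fun=> 0].
  have [hl|hl] := leqP l n.+1.
    exists (fun=> 0); split=> //; first by move=> y; exact: lie_zero.
    rewrite big1 => [|y _]; last exact: cbr0r.
    apply/funext => w; rewrite /lpart; have [wl|] := eqVneq; last by rewrite mulr0n.
    by rewrite hx ?wl // mul0rn.
  have [|g [g1 g2]] := lie_elt_adsum (asboolW (serP x) l); first by lia.
  by exists g; split=> //; rewrite leqNgt hl.
have [g hg] := choice hx.
pose G y : fps := fun w => g (size w).+1 y w.
have Gpart y l : lpart l (G y) = g l.+1 y.
  have [/(_ y) hl _ _] := hg l.+1; rewrite -[RHS](lie_elt_supp hl).
  by apply/funext => w; rewrite /lpart /G; have [->|] := eqVneq (size w) l.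
have GP y : lie_series (k - deg y) (G y).
  by apply/asboolP => l; rewrite Gpart; have [] := hg l.+1.
have e y : deg y + (k - deg y) = k by rewrite addrC subrK.
have -> : x = \sum_y hatL_br (e y) (hatL_gen erefl) (HatL (GP y)).
  apply: val_inj; rewrite raddf_sum /=; apply: lpart_ext => l.
  have [_ -> _] := hg l.
  have -> (F : X -> fps) : lpart l (\sum_y F y) = \sum_y lpart l (F y).
    by apply/funext => w; rewrite /lpart !fct_sumE sumrMnl.
  apply: eq_bigr => y _; rewrite lpart_cbr; case: l => [|l].
    rewrite big_ord_recl big_ord0 addr0 lpart_word /= cbr0l.
    by have [_ _ ->] := hg 0%N => //; rewrite cbr0r.
  rewrite (bigD1 (Ordinal (isT : (1 < l.+2)%N))) //= subSS subn0 Gpart.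
  rewrite lpart_word /= big1 ?addr0 // => p; rewrite lpart_word /=.
  case: (eqVneq 1%N p) => [hp|_ _]; last exact: cbr0l.
  by case/eqP; exact: val_inj.
apply: lin_span_sum => y; apply: lin_span_gen.
exists (deg y), (k - deg y), (e y), (hatL_gen erefl), (HatL (GP y)); split=> //.
by apply/IH => w hw /=; rewrite /G; have [_ _ ->] := hg (size w).+1.
Qed.

Lemma free_complete : complete free_gla.
Proof.
move=> k c hc c_dec.
have [x hx] := choice hc.
have c_le m n : (m <= n)%N -> c n `<=` c m.
  elim: n => [|n IH]; first by rewrite leqn0 => /eqP ->.
  rewrite leq_eqVlt ltnS => /orP[/eqP->//|/IH h].
  exact: subset_trans (c_dec n) h.
have xx m n w : (m <= n)%N -> (size w <= m)%N -> x n w = x m w.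
  move=> mn hw; have : c m (x n).
    by apply: (c_le _ _ mn); rewrite hx /lcs_coset /= subrr; apply/lcs_freeP.
  by rewrite hx => /lcs_freeP /(_ w hw) /eqP; rewrite subr_eq0 => /eqP.
pose y : fps := fun w => x (size w) w.
have yP : lie_series k y.
  apply/asboolP => l; have := asboolW (serP (x l)) l; congr lie_elt.
  by apply/funext => w; rewrite /lpart /y; have [->|] := eqVneq.
have cE n : c n = lcs_coset n (HatL yP : free_gla k).
  rewrite hx; apply/seteqP; split=> z /lcs_freeP hz; apply/lcs_freeP => w hw;
    have /eqP := hz w hw; rewrite !subr_eq0 => /eqP zw; apply/eqP; rewrite subr_eq0 zw.
  - by apply/eqP; exact: xx.
  - by apply/eqP; symmetry; exact: xx.
exists (HatL yP); split=> // z hz; apply: hatL_inj => w; symmetry.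
have : c (size w) z by rewrite hz /lcs_coset /= subrr; apply/lcs_freeP.
by rewrite cE => /lcs_freeP /(_ w (leqnn _)) /eqP; rewrite subr_eq0 => /eqP.
Qed.
End FreeLie.

Record category := Category {
  ob :> Type;
  mor : ob -> ob -> Type;
  idm : forall x, mor x x;
  cmp : forall x y z, mor y z -> mor x y -> mor x z;
  cmp_idl : forall x y (f : mor x y), cmp (idm y) f = f;
  cmp_idr : forall x y (f : mor x y), cmp f (idm x) = f;
  cmpA : forall x y z t (h : mor z t) (g : mor y z) (f : mor x y),
    cmp h (cmp g f) = cmp (cmp h g) f }.
Notation "g ∘ f" := (cmp g f) (at level 40, left associativity).

Record functor (C D : category) := Functor {
  fob :> C -> D;
  fmor : forall x y, mor x y -> mor (fob x) (fob y);
  fmor_id : forall x, fmor (idm x) = idm (fob x);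
  fmor_cmp : forall x y z (g : mor y z) (f : mor x y),
    fmor (g ∘ f) = fmor g ∘ fmor f }.

(* F is left adjoint to G. *)
Definition adjoint (C D : category) (F : functor C D) (G : functor D C) : Prop :=
  exists Phi : forall (c : C) (d : D), mor (F c) d -> mor c (G d),
    [/\ forall c d, bijective (@Phi c d),
        forall c d d' (h : mor d d') (f : mor (F c) d),
          Phi _ _ (h ∘ f) = fmor G h ∘ Phi _ _ f
      & forall c c' d (h : mor c' c) (f : mor (F c) d),
          Phi _ _ (f ∘ fmor F h) = Phi _ _ f ∘ h].

Record is_colimit (J E : category) (G : functor J E) (e : E)
    (inj : forall j : J, mor (G j) e) : Prop := IsColimit {
  colim_cocone : forall (j j' : J) (u : mor j j'), inj j' ∘ fmor G u = inj j;
  colim_univ : forall (e' : E) (t : forall j : J, mor (G j) e'),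
    (forall (j j' : J) (u : mor j j'), t j' ∘ fmor G u = t j) ->
    exists! h : mor e e', forall j, h ∘ inj j = t j }.

Section Kan.
Variables (C D E : category) (F : functor C D) (X : functor C E).

Section Comma.
Variable d : D.

Record comma_ob := CommaOb { comma_src : C; comma_arr : mor (F comma_src) d }.

Record comma_hom (a b : comma_ob) := CommaHom {
  comma_fun :> mor (comma_src a) (comma_src b);
  comma_tri : comma_arr b ∘ fmor F comma_fun = comma_arr a }.

Lemma comma_hom_eq a b (u v : comma_hom a b) :
  comma_fun u = comma_fun v -> u = v.
Proof.
by case: u v => [u hu] [v hv] /= uv; subst v; congr CommaHom; exact: Prop_irrelevance.
Qed.

Fact comma_id_subproof a : comma_arr a ∘ fmor F (idm (comma_src a)) = comma_arr a.
Proof. by rewrite fmor_id cmp_idr. Qed.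

Fact comma_cmp_subproof a b c (v : comma_hom b c) (u : comma_hom a b) :
  comma_arr c ∘ fmor F (v ∘ u) = comma_arr a.
Proof. by rewrite fmor_cmp cmpA !comma_tri. Qed.

Definition comma : category.
Proof.
refine (@Category comma_ob comma_hom (fun a => CommaHom (comma_id_subproof a))
  (fun a b c v u => CommaHom (comma_cmp_subproof v u)) _ _ _).
- by move=> *; apply: comma_hom_eq; exact: cmp_idl.
- by move=> *; apply: comma_hom_eq; exact: cmp_idr.
- by move=> *; apply: comma_hom_eq; exact: cmpA.
Defined.

(* The diagram F ↓ d -> C -> E whose colimit is the value at d of the left Kan
   extension of X along F. *)
Definition comma_diagram : functor comma E :=
  @Functor comma E (fun a => X (comma_src a)) (fun a b u => fmor X (comma_fun u))
    (fun a => fmor_id X _) (fun a b c v u => fmor_cmp X _ _).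
End Comma.

Definition comma_push (d d' : D) (f : mor d d') (a : comma d) : comma d' :=
  CommaOb (f ∘ comma_arr a).

(* A value at d of the pointwise left Kan extension of X along F.  It is a
   structure of its own because E need not have all colimits, so that the
   extension may be defined at some objects d only. *)
Record kan_at (d : D) := KanAt {
  kan_ob :> E;
  kan_in : forall a : comma d, mor (comma_diagram d a) kan_ob;
  kan_colim : is_colimit kan_in }.

(* h is the map induced by f between the values at d and d'. *)
Definition kan_induced (d d' : D) (A : kan_at d) (A' : kan_at d') (f : mor d d')
    (h : mor A A') : Prop :=
  forall a : comma d, h ∘ kan_in A a = kan_in A' (comma_push f a).

Record left_kan := LeftKan {
  lk_fun :> functor D E;
  lk_in : forall (d : D) (a : comma d), mor (comma_diagram d a) (lk_fun d);
  lk_colim : forall d, is_colimit (lk_in (d := d));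
  lk_induced : forall (d d' : D) (f : mor d d') (a : comma d),
    fmor lk_fun f ∘ lk_in a = lk_in (comma_push f a) }.
End Kan.

Lemma dgl_hom_eq (L M : dgl) (f g : dgl_hom L M) :
  (forall k (x : L k), f k x = g k x) -> f = g.
Proof.
case: f g => [f f1 f2 f3] [g g1 g2 g3] /= fg.
have e : f = g by apply/functional_extensionality_dep => k; exact/funext/fg.
by subst g; congr DglHom; exact: Prop_irrelevance.
Qed.

Definition dgl_id (L : dgl) : dgl_hom L L.
Proof. by exists (fun k x => x). Defined.

Definition dgl_cmp (L M N : dgl) (g : dgl_hom M N) (f : dgl_hom L M) :
  dgl_hom L N.
Proof.
exists (fun k x => g k (f k x)).
- by move=> k a x y; rewrite !dgl_hom_lin.
- by move=> *; rewrite !dgl_hom_br.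
- by move=> *; rewrite !dgl_hom_diff.
Defined.

Definition DGL : category.
Proof.
by refine (@Category dgl dgl_hom dgl_id dgl_cmp _ _ _) => *; exact: dgl_hom_eq.
Defined.

Record mono_map (n m : nat) := MonoMap {
  mono_fun :> 'I_n.+1 -> 'I_m.+1;
  mono_mono : {homo mono_fun : i j / (i <= j)%N} }.

Lemma mono_map_eq n m (f g : mono_map n m) : f =1 g -> f = g.
Proof.
case: f g => [f hf] [g hg] /= /funext fg; subst g.
by congr MonoMap; exact: Prop_irrelevance.
Qed.

Definition mono_id n : mono_map n n := @MonoMap n n id (fun i j h => h).

Definition mono_cmp n m p (g : mono_map m p) (f : mono_map n m) : mono_map n p :=
  @MonoMap n p (fun i => g (f i)) (fun i j h => mono_mono g (mono_mono f h)).

(* The simplex category; the object n is the ordinal [n] = {0, ..., n}. *)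
Definition Simplex : category.
Proof.
by refine (@Category nat mono_map mono_id mono_cmp _ _ _) => *; exact: mono_map_eq.
Defined.

Record sset := Sset {
  simplices :> nat -> Type;
  act : forall n m, mono_map n m -> simplices m -> simplices n;
  act_id : forall n (x : simplices n), act (mono_id n) x = x;
  act_cmp : forall n m p (g : mono_map m p) (f : mono_map n m) (x : simplices p),
    act (mono_cmp g f) x = act f (act g x) }.

Record sset_hom (K K' : sset) := SsetHom {
  sset_fun :> forall n, K n -> K' n;
  sset_nat : forall n m (f : mono_map n m) (x : K m),
    sset_fun (act f x) = act f (sset_fun x) }.

Lemma sset_hom_eq (K K' : sset) (f g : sset_hom K K') :
  (forall n (x : K n), f n x = g n x) -> f = g.
Proof.
case: f g => [f hf] [g hg] /= fg.
have e : f = g by apply/functional_extensionality_dep => k; exact/funext/fg.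
by subst g; congr SsetHom; exact: Prop_irrelevance.
Qed.

Definition sset_id (K : sset) : sset_hom K K := @SsetHom K K (fun n x => x)
  (fun n m f x => erefl).

Definition sset_cmp (K1 K2 K3 : sset) (g : sset_hom K2 K3) (f : sset_hom K1 K2) :
  sset_hom K1 K3.
Proof. by exists (fun n x => g n (f n x)) => *; rewrite !sset_nat. Defined.

Definition SimpSet : category.
Proof.
by refine (@Category sset sset_hom sset_id sset_cmp _ _ _) => *; exact: sset_hom_eq.
Defined.

Definition std_simplex (n : nat) : sset.
Proof.
by refine (@Sset (fun m => mono_map m n) (fun m p f x => mono_cmp x f) _ _) => *;
  exact: mono_map_eq.
Defined.

Definition std_map n m (f : mono_map n m) : sset_hom (std_simplex n) (std_simplex m).
Proof.
by exists (fun p x => mono_cmp f x) => *; exact: mono_map_eq.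
Defined.

Definition std_functor : functor Simplex SimpSet.
Proof.
by refine (@Functor Simplex SimpSet std_simplex std_map _ _) => *;
  apply: sset_hom_eq => *; exact: mono_map_eq.
Defined.

(* The generator a_{i_0...i_p} is indexed by the nonempty set {i_0 < ... < i_p}. *)
Definition face (n : nat) := {s : {set 'I_n.+1} | s != finset.set0}.

Definition face_deg n (s : face n) : int := #|val s|%:Z - 2.

(* The underlying graded Lie algebra of 𝔏_n. *)
Definition hatL_simplex (n : nat) : gla := free_gla (@face_deg n).

Definition gen n (s : face n) (k : int) (e : face_deg s = k) : hatL_simplex n k :=
  hatL_gen e.

Fact set1_neq0 n (i : 'I_n.+1) : [set i]%SET != finset.set0.
Proof. by apply/set0Pn; exists i; rewrite inE. Qed.

Definition vertex n (i : 'I_n.+1) : face n := exist _ [set i]%SET (set1_neq0 i).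

Fact vertex_deg n (i : 'I_n.+1) : face_deg (vertex i) = -1.
Proof. by rewrite /face_deg /= cards1. Qed.

(* The coefficient of a_t in d a_s. *)
Definition boundary_coef n (s t : face n) : rat :=
  \sum_(i in val s | (val s :\ i)%SET == val t)
    (-1) ^+ #|[set j in val s | (j < i)%N]%SET|.

(* The coefficient of the generator a_t in the linear part of x. *)
Definition linear_coef n (k : int) (x : hatL_simplex n k) (t : face n) : rat :=
  ser x [:: t].

Fact lift_mono n (i : 'I_n.+2) : {homo @lift n.+2 i : j k / (j <= k)%N}.
Proof. by move=> j k jk; rewrite /= leq_bump2. Qed.

Definition coface n (i : 'I_n.+2) : mono_map n n.+1 := MonoMap (@lift_mono n i).

Fact coface_face_neq0 n (i : 'I_n.+2) (s : face n) :
  (coface i @: val s)%SET != finset.set0.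
Proof. by rewrite imset_eq0; exact: valP s. Qed.

Definition coface_face n (i : 'I_n.+2) (s : face n) : face n.+1 :=
  exist _ (coface i @: val s)%SET (coface_face_neq0 i s).

Definition free_dgl n (d : differential (hatL_simplex n)) : dgl :=
  Dgl d (@free_complete _ _).

(* f is δ_i: a Lie morphism out of the completed free Lie algebra on finitely
   many generators is determined by their images. *)
Definition is_delta n (d : differential (hatL_simplex n))
    (d' : differential (hatL_simplex n.+1)) (i : 'I_n.+2)
    (f : dgl_hom (free_dgl d) (free_dgl d')) : Prop :=
  forall (s : face n) (k : int) (e : face_deg s = k)
    (e' : face_deg (coface_face i s) = k),
  f k (gen e) = gen e'.

Record compatible_models := CompatibleModels {
  cm_diff : forall n, differential (hatL_simplex n);
  cm_mc : forall n (i : 'I_n.+1),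
    @maurer_cartan (free_dgl (cm_diff n)) (gen (vertex_deg i));
  cm_linear : forall n (s t : face n),
    linear_coef (diff (cm_diff n) erefl (gen (erefl (face_deg s)))) t
    = boundary_coef s t;
  cm_delta : forall n (i : 'I_n.+2),
    exists f : dgl_hom (free_dgl (cm_diff n)) (free_dgl (cm_diff n.+1)),
      is_delta i f }.

Definition model (M : compatible_models) (n : nat) : dgl := free_dgl (cm_diff M n).

Record cosimplicial (M : compatible_models) := Cosimplicial {
  cs_map : forall n m, mono_map n m -> dgl_hom (model M n) (model M m);
  cs_id : forall n, cs_map (mono_id n) = dgl_id (model M n);
  cs_cmp : forall n m p (g : mono_map m p) (f : mono_map n m),
    cs_map (mono_cmp g f) = dgl_cmp (cs_map g) (cs_map f);
  cs_coface : forall n (i : 'I_n.+2), is_delta i (cs_map (coface i)) }.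

Section Realization.
Variables (M : compatible_models) (S : cosimplicial M).

Definition models_functor : functor Simplex DGL :=
  @Functor Simplex DGL (model M) (cs_map S) (cs_id S) (cs_cmp S).

Definition realization_sset (L : dgl) : sset.
Proof.
refine (@Sset (fun n => dgl_hom (model M n) L)
          (fun n m f x => dgl_cmp x (cs_map S f)) _ _).
- by move=> n x; rewrite cs_id; exact: dgl_hom_eq.
- by move=> n m p g f x; rewrite cs_cmp; exact: dgl_hom_eq.
Defined.

Definition realization_map (L L' : dgl) (h : dgl_hom L L') :
  sset_hom (realization_sset L) (realization_sset L').
Proof.
by exists (fun n x => dgl_cmp h x) => *; exact: dgl_hom_eq.
Defined.

Definition realization : functor DGL SimpSet.
Proof.
by refine (@Functor DGL SimpSet realization_sset realization_map _ _) => *;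
  apply: sset_hom_eq => *; exact: dgl_hom_eq.
Defined.
End Realization.

(* Main.v *)
Require Import Defs.
From mathcomp Require Import all_boot all_order all_algebra all_classical.
Set Implicit Arguments.
Unset Strict Implicit.
Unset Printing Implicit Defensive.

(** A simplicial set [K] is the colimit of its simplices, so a map from [K] to
    [⟨L⟩ = DGL(𝔏_•, L)] amounts to choosing, for each n-simplex [x] of [K], a
    morphism [𝔏_n -> L], compatibly with all monotone maps.  By the Yoneda lemma
    the n-simplices of [K] are the objects of the comma category [std_functor ↓ K]
    lying over [n] ([simplex_objK], [obj_simplexK]), and under this identification
    the compatibility of the choices ([sset_nat]) is exactly the cocone condition
    over the diagram whose colimit is [𝔏(K)] ([transpose_nat], [simplexwise_cocone]).
    The universal property of the colimit then yields the bijection.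

    The transpose of [f : 𝔏(K) -> L] therefore sends [x] to the composite of [f]
    with the coprojection at [x].  Naturality in [L] is associativity of
    composition, and naturality in [K] holds because the induced map
    [𝔏(K) -> 𝔏(K')] carries the coprojection at [x] to the one at the image of
    [x]. *)

Section Yoneda.
Variable K : SimpSet.

Definition char_map n (x : (K : sset) n) : sset_hom (std_simplex n) K.
Proof.
exists (fun m (u : std_simplex n m) => act u x) => m p u v.
exact: act_cmp.
Defined.

Definition simplex_obj n (x : (K : sset) n) : comma std_functor K :=
  @CommaOb _ _ std_functor K n (char_map x).

Definition obj_simplex (a : comma std_functor K) : (K : sset) (comma_src a) :=
  (comma_arr a : sset_hom _ _) _ (mono_id _).

Lemma simplex_objK n (x : (K : sset) n) : obj_simplex (simplex_obj x) = x.
Proof. exact: act_id. Qed.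

(** Yoneda: a map out of the standard simplex is determined by the image of the
    identity, since every simplex of it is a pullback of the identity. *)
Lemma obj_simplexK (a : comma std_functor K) : simplex_obj (obj_simplex a) = a.
Proof.
case: a => n k; congr CommaOb; apply: sset_hom_eq => m u /=.
rewrite /obj_simplex /= -sset_nat; congr ((k : sset_hom _ _) _ _).
exact: mono_map_eq.
Qed.

Definition simplex_mor n m (u : mono_map n m) (x : (K : sset) m) :
  comma_hom (simplex_obj (act u x)) (simplex_obj x).
Proof.
apply: (@CommaHom _ _ std_functor K (simplex_obj (act u x)) (simplex_obj x) u).
by apply: sset_hom_eq => p v; rewrite /= act_cmp.
Defined.

Lemma obj_simplex_mor (a b : comma std_functor K) (u : mor a b) :
  act (comma_fun u) (obj_simplex b) = obj_simplex a.
Proof.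
rewrite /obj_simplex -(comma_tri u) /= -sset_nat.
congr ((comma_arr b : sset_hom _ _) _ _); exact: mono_map_eq.
Qed.
End Yoneda.

Section Transpose.
Variables (M : compatible_models) (S : cosimplicial M).
Local Notation kan := (kan_at std_functor (models_functor S)).

Section Bijection.
Variables (K : SimpSet) (A : kan K) (L : DGL).

(** The maps [simplex_mor u x] of the comma category are what turn the cocone
    condition into naturality of the transpose. *)
Lemma transpose_nat (f : mor (kan_ob A) L) n m (u : mono_map n m)
    (x : (K : sset) m) :
  (f ∘ kan_in A (simplex_obj (act u x)) : realization_sset S L n) =
  act u (f ∘ kan_in A (simplex_obj x) : realization_sset S L m).
Proof.
rewrite -(colim_cocone (kan_colim A) (simplex_mor u x)).
exact: (@cmpA DGL _ _ _ _ f (kan_in A (simplex_obj x))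
          (fmor (models_functor S) u)).
Qed.

Definition transpose (f : mor (kan_ob A) L) : mor K (realization S L) :=
  @SsetHom K (realization_sset S L)
    (fun n x => f ∘ kan_in A (simplex_obj x)) (transpose_nat f).

(** The source of [kan_in A a] depends on [a], so [a] cannot be replaced by
    [simplex_obj (obj_simplex a)] in the coprojection alone; this form makes the
    coprojections at arbitrary objects available. *)
Lemma transposeE (f : mor (kan_ob A) L) (a : comma std_functor K) :
  (transpose f : sset_hom _ _) _ (obj_simplex a) = f ∘ kan_in A a.
Proof. by rewrite -(obj_simplexK a) simplex_objK. Qed.

Lemma simplexwise_cocone (g : sset_hom K (realization_sset S L))
    (a b : comma std_functor K) (u : mor a b) :
  (g _ (obj_simplex b) : mor (models_functor S (comma_src b)) L)
    ∘ fmor (comma_diagram std_functor (models_functor S) K) u =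
  g _ (obj_simplex a).
Proof. by rewrite -(obj_simplex_mor u) sset_nat. Qed.

(** By Yoneda the transpose of [f] records all composites of [f] with the
    coprojections, and these determine [f] and can be prescribed by any
    cocone. *)
Lemma transpose_bij : bijective transpose.
Proof.
have uniq_map (g : sset_hom K (realization_sset S L)) :=
  colim_univ (kan_colim A) (simplexwise_cocone g).
pose untranspose g := projT1 (cid (uniq_map g)).
have untransposeP g a :
    untranspose g ∘ kan_in A a = (g : sset_hom _ _) _ (obj_simplex a).
  by have [] := projT2 (cid (uniq_map g)).
exists untranspose => [f|g].
  have [_ untranspose_uniq] := projT2 (cid (uniq_map (transpose f))).
  by apply: untranspose_uniq => a; rewrite transposeE.
apply: sset_hom_eq => n x.
by have := untransposeP g (simplex_obj x); rewrite simplex_objK.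
Qed.
End Bijection.

Lemma transpose_natr (K : SimpSet) (A : kan K) (L L' : DGL) (h : mor L L')
    (f : mor (kan_ob A) L) :
  transpose (h ∘ f) = fmor (realization S) h ∘ transpose f.
Proof.
by apply: sset_hom_eq => n x; exact/esym/(cmpA h f (kan_in A (simplex_obj x))).
Qed.

(** The induced map carries the coprojection at [x] to the one at the
    pushforward of [x] along [k], which represents the simplex [k x]. *)
Lemma transpose_natl (K K' : SimpSet) (A : kan K) (A' : kan K') (k : mor K K')
    (Lk : mor (kan_ob A) (kan_ob A')) : kan_induced k Lk ->
  forall (L : DGL) (f : mor (kan_ob A') L),
  transpose (f ∘ Lk) = transpose f ∘ k.
Proof.
move=> ind L f; apply: sset_hom_eq => n x.
apply: etrans (esym (cmpA f Lk (kan_in A (simplex_obj x)))) _.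
rewrite ind; apply: etrans (esym (transposeE f (comma_push k (simplex_obj x)))) _.
(* [obj_simplex (comma_push k a)] is by definition [k] at [obj_simplex a]. *)
exact: (congr1 ((transpose f ∘ k : sset_hom K (realization_sset S L)) n)
          (simplex_objK x)).
Qed.
End Transpose.

(* MathComp world, with mathcomp.classical.  The first conjunct is the
   adjunction for a model functor defined on all simplicial sets; the second is
   the natural bijection at every simplicial set K, for any colimit A = 𝔏(K). *)
Theorem theoremB (M : compatible_models) (S : cosimplicial M) :
  (forall LL : left_kan std_functor (models_functor S),
     adjoint LL (realization S)) /\
  (exists Phi : forall (K : SimpSet)
      (A : kan_at std_functor (models_functor S) K) (L : DGL),
      mor A L -> mor K (realization S L),
    [/\ forall (K : SimpSet) (A : kan_at std_functor (models_functor S) K)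
            (L : DGL),
          bijective (Phi K A L),
        forall (K : SimpSet) (A : kan_at std_functor (models_functor S) K)
            (L L' : DGL) (h : mor L L') (f : mor A L),
          Phi K A L' (h ∘ f) = fmor (realization S) h ∘ Phi K A L f
      & forall (K K' : SimpSet) (A : kan_at std_functor (models_functor S) K)
            (A' : kan_at std_functor (models_functor S) K')
            (k : mor K K') (Lk : mor A A'), kan_induced k Lk ->
          forall (L : DGL) (f : mor A' L),
          Phi K A L (f ∘ Lk) = Phi K' A' L f ∘ k]).
Proof.
split=> [LL|].
  (* The values of a left Kan extension are pointwise ones. *)
  pose A K : kan_at std_functor (models_functor S) K := KanAt (lk_colim LL K).
  exists (fun K L => @transpose M S K (A K) L); split.
  - by move=> K L; exact (transpose_bij (A K) L).
  - by move=> K L L' h f; exact (transpose_natr (A := A K) h f).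
  - move=> K K' L k f; apply: (@transpose_natl M S _ _ (A _) (A _)) => a.
    exact: lk_induced.
exists (@transpose M S); split.
- by move=> K A L; exact: transpose_bij.
- by move=> K A L L' h f; exact: transpose_natr.
- by move=> K K' A A' k Lk ind L f; exact: transpose_natl.
Qed.
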